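(* Let $(\mathcal M,g)$ be the Bardeen spacetime with parameters $M\ne0$, $e\ne0$, with coordinates $(t,\rho,\theta,\phi)$ and $\rho_1=(e^2+\rho^2)^{1/2}$. Put $\varrho_1=\frac{M(18\rho_1^2-25\rho^2)}{25\rho^2\rho_1^3}$, $\varrho_2=\frac{\rho_1^2(6\rho_1^2-5\rho^2)}{25e^2\rho^2}$, $\varrho_3=\frac{(3\rho_1^2-5\rho^2)\rho_1^7}{150Me^4\rho^2}$, so that $R=\varrho_1\,g\wedge g+\varrho_2\,g\wedge S+\varrho_3\,S\wedge S$. Then: (i) $R\cdot R=\varrho_R\,Q(g,R)$, where $\varrho_R=-\dfrac{M(2\rho_1^2-3\rho^2)}{\rho_1^5}$, and $\varrho_R=\dfrac{1}{2\varrho_3}\big(2(\varrho_2^2-4\varrho_3\varrho_1)-\varrho_2\big)$ where $\varrho_3\neq0$; (ii) $R\cdot C=\varrho_R\,Q(g,C)$; (iii) $C\cdot R=\varrho_C\,Q(g,R)$, where $\varrho_C=-\dfrac{M\rho^2(3\rho_1^2-5\rho^2)}{2\rho_1^7}$, and $\varrho_C=\varrho_R-\Big(\dfrac{\kappa}{3}+\dfrac{\varrho_2}{2\varrho_3}\Big)+\dfrac{1}{4\varrho_3}$ where $\varrho_3\neq0$; (iv) $C\cdot C=\varrho_C\,Q(g,C)$; (v) on the open set $\{3\rho_1^2\ne5\rho^2\}$, $R\cdot R=Q(S,R)+\varrho\,Q(g,C)$, where $\varrho=\varrho_R+\dfrac{\varrho_2}{2\varrho_3}=\dfrac{2M(6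\rho_1^2-7\rho^2)}{(3\rho_1^2-5\rho^2)\rho_1^3}$.
   Context: Bardeen spacetime: the $4$-dimensional semi-Riemannian manifold with coordinates $(x^1,x^2,x^3,x^4)=(t,\rho,\theta,\phi)$, $\rho>0$, $0<\theta<\pi$, on the region where $\rho_1^3\ne 2M\rho^2$, with $\rho_1=(e^2+\rho^2)^{1/2}$ and metric $$g=-\Big(1-\tfrac{2M\rho^2}{\rho_1^3}\Big)dt^2+\Big(1-\tfrac{2M\rho^2}{\rho_1^3}\Big)^{-1}d\rho^2+\rho^2(d\theta^2+\sin^2\theta\,d\phi^2).$$ $n=4$, and $\nabla$ is the Levi-Civita connection. For a symmetric $(0,2)$-tensor $\tau$: $(\zeta_1\wedge_\tau\zeta_2)X=\tau(\zeta_2,X)\zeta_1-\tau(\zeta_1,X)\zeta_2$. Sign convention: $\mu_R(X,Y)Z=-(\nabla_X\nabla_YZ-\nabla_Y\nabla_XZ-\nabla_{[X,Y]}Z)$ and $S(X,Y)=\mathrm{tr}(Z\mapsto\mu_R(Z,X)Y)$; thus e.g. $R_{3434}=2M\rho^4\sin^2\theta/\rho_1^3$ and $S_{33}=-6Me^2\rho^2/\rho_1^5$. $\mathscr J$ is the Ricci operator, $g(\zeta_1,\mathscr J\zeta_2)=S(\zeta_1,\zeta_2)$, and $\kappa=\mathrm{tr}\,\mathscr J$. The conformal (Weyl) operator is $\mu_C(\zeta_1,\zeta_2)=\mu_R(\zeta_1,\zeta_2)-\frac{1}{n-2}(\zeta_1\wedge_g\mathscr J\zeta_2+\mathscr J\zeta_1\wedge_g\zeta_2)+\frac{\kappa}{(n-1)(n-2)}\zeta_1\wedge_g\zeta_2$.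 For $D\in\{R,C\}$ the $(0,4)$-tensor is $D(\zeta_1,\zeta_2,\zeta_3,\zeta_4)=g(\mu_D(\zeta_1,\zeta_2)\zeta_3,\zeta_4)$. For a $(0,l)$-tensor $\eta$ and a symmetric $(0,2)$-tensor $\lambda$: $(D\cdot\eta)(\zeta_1,\dots,\zeta_l;X,Y)=-\sum_{i=1}^l\eta(\zeta_1,\dots,\mu_D(X,Y)\zeta_i,\dots,\zeta_l)$ and $Q(\lambda,\eta)(\zeta_1,\dots,\zeta_l;X,Y)=-\sum_{i=1}^l\eta(\zeta_1,\dots,(X\wedge_\lambda Y)\zeta_i,\dots,\zeta_l)$. Kulkarni–Nomizu product: $(\tau\wedge\lambda)(\zeta_1,\zeta_2,X,Y)=\tau(\zeta_1,Y)\lambda(\zeta_2,X)-\tau(\zeta_1,X)\lambda(\zeta_2,Y)+\tau(\zeta_2,X)\lambda(\zeta_1,Y)-\tau(\zeta_2,Y)\lambda(\zeta_1,X)$. *)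

(* Defs.v *)
From mathcomp Require Import all_boot all_order all_algebra.
From mathcomp Require Import all_classical all_reals all_analysis.
From mathcomp Require Import ring.
Import Order.TTheory GRing.Theory Num.Theory.
Import numFieldNormedType.Exports.
Set Implicit Arguments.
Unset Strict Implicit.
Unset Printing Implicit Defensive.
Local Open Scope classical_set_scope.
Local Open Scope ring_scope.

(* Pointwise tensor algebra on a tangent space 'rV_n, identified with R^n by
   the coordinate basis.  A (0,2)-tensor is a curried function, a (0,l)-tensor
   a function of an l-indexed family of vectors. *)
Section TensorAlgebra.
Variables (R : realType) (n : nat).
Implicit Types (u v w x : 'rV[R]_n) (tau lam : 'rV[R]_n -> 'rV[R]_n -> R).

Definition tensor (l : nat) := ('I_l -> 'rV[R]_n) -> R.

Definition basis (i : 'I_n) : 'rV[R]_n := delta_mx 0 i.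

Definition trace_op (A : 'rV[R]_n -> 'rV[R]_n) : R :=
  \sum_(i < n) (A (basis i)) 0 i.

(* (u /\_tau v) w *)
Definition wedge_op tau u v w : 'rV[R]_n := tau v w *: u - tau u w *: v.

Definition kulkarni_nomizu tau lam : tensor 4 := fun z =>
  let a := z 0 in let b := z 1 in let x := z 2 in let y := z 3 in
  tau a y * lam b x - tau a x * lam b y + tau b x * lam a y - tau b y * lam a x.

(* The derivation of the tensor algebra induced by the endomorphism A;
   [dfwith z v] is z with its i-th entry replaced by v : T i. *)
Definition derivation (A : 'rV[R]_n -> 'rV[R]_n) (l : nat) (eta : tensor l) :
    tensor l := fun z =>
  - \sum_(i < l) eta (@dfwith 'I_l (fun=> 'rV[R]_n) z i (A (z i))).

(* (D . eta)(z; X, Y), the tensor D being given by its operators mu X Y *)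
Definition curv_dot (mu : 'rV[R]_n -> 'rV[R]_n -> 'rV[R]_n -> 'rV[R]_n)
    (l : nat) (eta : tensor l) (z : 'I_l -> 'rV[R]_n) (X Y : 'rV[R]_n) : R :=
  derivation (mu X Y) eta z.

(* Q(lam, eta)(z; X, Y) *)
Definition tachibana lam (l : nat) (eta : tensor l)
    (z : 'I_l -> 'rV[R]_n) (X Y : 'rV[R]_n) : R :=
  derivation (wedge_op lam X Y) eta z.

End TensorAlgebra.

(* Semi-Riemannian geometry in a coordinate chart of R^n; g p is the matrix of
   the metric at p in the coordinate basis. *)
Section Geometry.
Variables (R : realType) (n : nat) (g : 'rV[R]_n -> 'M[R]_n).
Implicit Types (p u v w : 'rV[R]_n) (X Y Z : 'rV[R]_n -> 'rV[R]_n).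

Definition metric p u v : R := (u *m g p *m v^T) 0 0.

Definition partial (i : 'I_n) (f : 'rV[R]_n -> R) p : R := 'D_(basis R i) f p.

(* Gamma^k_{ij} *)
Definition christoffel p (k i j : 'I_n) : R :=
  2^-1 * \sum_(l < n) (invmx (g p)) k l *
    (partial i (fun q => g q j l) p + partial j (fun q => g q i l) p
     - partial l (fun q => g q i j) p).

(* Levi-Civita connection; see [levi_civita_torsion_free] and
   [levi_civita_metric]. *)
Definition nabla X Y : 'rV[R]_n -> 'rV[R]_n := fun p =>
  \row_(k < n) ('D_(X p) (fun q => Y q 0 k) p +
    \sum_(i < n) \sum_(j < n) christoffel p k i j * X p 0 i * Y p 0 j).

Definition lie_bracket X Y : 'rV[R]_n -> 'rV[R]_n := fun p =>
  \row_(k < n) ('D_(X p) (fun q => Y q 0 k) p - 'D_(Y p) (fun q => X q 0 k) p).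

Definition curvature_field X Y Z : 'rV[R]_n -> 'rV[R]_n := fun p =>
  - (nabla X (nabla Y Z) p - nabla Y (nabla X Z) p
     - nabla (lie_bracket X Y) Z p).

(* The curvature is tensorial: its value on tangent vectors at p does not
   depend on the vector fields extending them, and is computed here with the
   extensions that have constant coordinates. *)
Definition riemann_op p u v w : 'rV[R]_n :=
  curvature_field (cst u) (cst v) (cst w) p.

Definition ricci p u v : R := trace_op (fun z => riemann_op p z u v).

(* The vector J v determined by g(u, J v) = S(u, v) for all u *)
Definition ricci_op p v : 'rV[R]_n :=
  (\row_(i < n) ricci p (basis R i) v) *m invmx (g p).

Definition scalar_curvature p : R := trace_op (ricci_op p).

Definition weyl_op p u v w : 'rV[R]_n :=
  riemann_op p u v w
  - (n%:R - 2)^-1 *: (wedge_op (metric p) u (ricci_op p v) w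
                      + wedge_op (metric p) (ricci_op p u) v w)
  + (scalar_curvature p / ((n%:R - 1) * (n%:R - 2))) *:
      wedge_op (metric p) u v w.

(* D(z0, z1, z2, z3) = g(mu(z0, z1) z2, z3) *)
Definition lower_op (mu : 'rV[R]_n -> 'rV[R]_n -> 'rV[R]_n -> 'rV[R]_n) p :
    tensor R n 4 :=
  fun z => metric p (mu (z 0) (z 1) (z 2)) (z 3).

Definition riemann p : tensor R n 4 := lower_op (riemann_op p) p.
Definition weyl p : tensor R n 4 := lower_op (weyl_op p) p.

Hypothesis g_sym : forall p, (g p)^T = g p.

Lemma christoffel_sym p k i j : christoffel p k i j = christoffel p k j i.
Proof.
rewrite /christoffel; congr (_ * _); apply: eq_bigr => l _; congr (_ * _).
rewrite [X in X - _]addrC; congr (_ - _).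
by congr (partial l _ p); apply/funext => q; rewrite -[in LHS]g_sym mxE.
Qed.

Lemma levi_civita_torsion_free X Y p :
  nabla X Y p - nabla Y X p = lie_bracket X Y p.
Proof.
apply/rowP => k; rewrite !mxE.
rewrite [X in _ - (_ + X)]exchange_big /=.
under [X in _ - (_ + X)]eq_bigr do under eq_bigr do
  rewrite christoffel_sym mulrAC.
by rewrite opprD addrACA subrr addr0.
Qed.

Lemma lower_christoffel p i j l : g p \in unitmx ->
  \sum_(k < n) g p l k * christoffel p k i j =
  2^-1 * (partial i (fun q => g q j l) p + partial j (fun q => g q i l) p
     - partial l (fun q => g q i j) p).
Proof.
move=> gU; rewrite /christoffel.
under eq_bigr do rewrite mulrCA mulr_sumr.
rewrite -mulr_sumr exchange_big /=; congr (_ * _).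
under eq_bigr do (under eq_bigr do rewrite mulrA; rewrite -mulr_suml).
rewrite (bigD1 l) //= [X in _ + X]big1 ?addr0 => [|m ml].
  have := congr1 (fun (A : 'M[R]_n) => A l l) (mulmxV gU).
  by rewrite !mxE eqxx => ->; rewrite mul1r.
have := congr1 (fun (A : 'M[R]_n) => A l m) (mulmxV gU).
by rewrite !mxE eq_sym (negPf ml) => ->; rewrite mul0r.
Qed.

Lemma levi_civita_metric X Y Z p : g p \in unitmx ->
  (forall i j, differentiable (fun q => g q i j) p) ->
  (forall i, differentiable (fun q => Y q 0 i) p) ->
  (forall i, differentiable (fun q => Z q 0 i) p) ->
  'D_(X p) (fun q => metric q (Y q) (Z q)) p =
  metric p (nabla X Y p) (Z p) + metric p (Y p) (nabla X Z p).
Proof.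
move=> gU dg dY dZ.
have mE q u v : metric q u v = \sum_(i < n) \sum_(j < n) u 0 i * g q i j * v 0 j.
  rewrite /metric mxE exchange_big /=; apply: eq_bigr => j _.
  by rewrite !mxE mulr_suml.
have Dg i j : 'D_(X p) (fun q => g q i j) p =
    \sum_(k < n) X p 0 k * partial k (fun q => g q i j) p.
  rewrite deriveE // [X in 'd _ _ X]row_sum_delta linear_sum.
  by apply: eq_bigr => k _; rewrite linearZ /= /partial deriveE.
have -> : (fun q => metric q (Y q) (Z q)) = \sum_(i < n) \sum_(j < n)
    (fun q => Y q 0 i) * (fun q => g q i j) * (fun q => Z q 0 j).
  apply/funext => q; rewrite mE fct_sumE; apply: eq_bigr => i _.
  by rewrite fct_sumE.
have der (f : 'rV[R]_n -> R) : differentiable f p -> derivable f p (X p).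
  exact: diff_derivable.
have dYg i j : derivable ((fun q => Y q 0 i) * (fun q => g q i j)) p (X p).
  by apply: derivableM; apply: der.
rewrite derive_sum => [|i]; last first.
  by apply: derivable_sum => j; apply: derivableM => //; apply: der.
under eq_bigr => i _.
  rewrite derive_sum => [|j]; last by apply: derivableM => //; apply: der.
  under eq_bigr => j _.
    rewrite deriveM //; last exact: der.
    rewrite deriveM; [|exact: der..].
    over.
  over.
pose GY k := \sum_(i < n) \sum_(j < n) christoffel p k i j * X p 0 i * Y p 0 j.
pose GZ k := \sum_(i < n) \sum_(j < n) christoffel p k i j * X p 0 i * Z p 0 j.
pose L l i j := \sum_(k < n) g p l k * christoffel p k i j.
have gs q i j : g q i j = g q j i by rewrite -[in LHS]g_sym mxE.
have sumY : \sum_(i < n) \sum_(j < n) GY i * g p i j * Z p 0 j =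
    \sum_(i < n) \sum_(j < n) \sum_(a < n) X p 0 a * Y p 0 i * Z p 0 j * L j a i.
  rewrite exchange_big [RHS]exchange_big /=; apply: eq_bigr => j _.
  rewrite [RHS]exchange_big /= /GY /L.
  under eq_bigr do rewrite -mulrA mulr_suml.
  rewrite exchange_big /=; apply: eq_bigr => a _.
  under eq_bigr do rewrite mulr_suml.
  rewrite exchange_big /=; apply: eq_bigr => i _.
  rewrite mulr_sumr; apply: eq_bigr => k _.
  by rewrite (gs p k j); ring.
have sumZ : \sum_(i < n) \sum_(j < n) Y p 0 i * g p i j * GZ j =
    \sum_(i < n) \sum_(j < n) \sum_(a < n) X p 0 a * Y p 0 i * Z p 0 j * L i a j.
  apply: eq_bigr => i _; rewrite [RHS]exchange_big /= /GZ /L.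
  under eq_bigr do rewrite mulr_sumr.
  rewrite exchange_big /=; apply: eq_bigr => a _.
  under eq_bigr do rewrite mulr_sumr.
  rewrite exchange_big /=; apply: eq_bigr => b _.
  rewrite mulr_sumr; apply: eq_bigr => k _.
  by ring.
transitivity (\sum_(i < n) \sum_(j < n)
    ('D_(X p) (fun q => Y q 0 i) p * g p i j * Z p 0 j +
     Y p 0 i * g p i j * 'D_(X p) (fun q => Z q 0 j) p) +
   (\sum_(i < n) \sum_(j < n) GY i * g p i j * Z p 0 j +
    \sum_(i < n) \sum_(j < n) Y p 0 i * g p i j * GZ j)); last first.
  rewrite !mE -!big_split /=; apply: eq_bigr => i _.
  rewrite -!big_split /=; apply: eq_bigr => j _.
  by rewrite !mxE -/(GY i) -/(GZ j); ring.
rewrite sumY sumZ -!big_split /=; apply: eq_bigr => i _.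
rewrite -!big_split /=; apply: eq_bigr => j _.
rewrite -big_split /= Dg.
under [X in _ = _ + X]eq_bigr => a _.
  have -> : X p 0 a * Y p 0 i * Z p 0 j * L j a i +
      X p 0 a * Y p 0 i * Z p 0 j * L i a j =
      Y p 0 i * Z p 0 j * (X p 0 a * partial a (fun q => g q i j) p).
    rewrite /L !lower_christoffel //.
    have -> : (fun q => g q j i) = (fun q => g q i j).
      by apply/funext => q; rewrite gs.
    by field.
  over.
by rewrite -mulr_sumr /GRing.scale /= !fctE; ring.
Qed.

Lemma metric_ricci_op p u v : g p \in unitmx ->
  metric p u (ricci_op p v) = \sum_(i < n) u 0 i * ricci p (basis R i) v.
Proof.
move=> gU; rewrite /metric /ricci_op trmx_mul trmx_inv g_sym mulmxA mulmxK //.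
by rewrite mxE; apply: eq_bigr => i _; rewrite !mxE.
Qed.

End Geometry.

Section Bardeen.
Variables (R : realType) (M e : R).
Implicit Type p : 'rV[R]_4.

(* coordinates p = (t, rho, theta, phi) *)
Definition bardeen_rho p : R := p 0 1.
Definition bardeen_theta p : R := p 0 2.

Definition bardeen_rho1 p : R := Num.sqrt (e ^+ 2 + bardeen_rho p ^+ 2).

Definition bardeen_lapse p : R :=
  1 - 2 * M * bardeen_rho p ^+ 2 / bardeen_rho1 p ^+ 3.

Definition bardeen_metric p : 'M[R]_4 :=
  diag_mx (\row_(i < 4)
    [:: - bardeen_lapse p; (bardeen_lapse p)^-1; bardeen_rho p ^+ 2;
        bardeen_rho p ^+ 2 * sin (bardeen_theta p) ^+ 2]`_i).

Definition bardeen_spacetime : set 'rV[R]_4 :=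
  [set p | [/\ 0 < bardeen_rho p, 0 < bardeen_theta p < pi &
               bardeen_rho1 p ^+ 3 != 2 * M * bardeen_rho p ^+ 2]].

End Bardeen.

(* Main.v *)
Require Import Defs.
From mathcomp Require Import all_boot all_order all_algebra.
From mathcomp Require Import all_classical all_reals all_analysis.
From mathcomp Require Import ring lra.
Import Order.TTheory GRing.Theory Num.Theory.
Import numFieldNormedType.Exports.
Local Open Scope classical_set_scope.
Local Open Scope ring_scope.

(**
At each point the coordinate basis is orthogonal and diagonalizes the whole
curvature: the operator mu_R(u, v) is a sum over pairs of coordinates (k, i) of
the opposite K(k, i) of a sectional curvature times the elementary rotation of
the plane (k, i).  By spherical symmetry and by the relation g_tt g_rr = -1,
K takes only three values: a on the (t, rho) plane, d on the sphere, and one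
common value b on the four mixed planes.  The Ricci operator is then diagonal
with at most two eigenvalues, s1 = a + 2 b on t, rho and s2 = d + 2 b on
theta, phi.

Let mu(X, Y) act on tensors as a derivation.  It is skew, so it kills g.  It
acts on S only through the planes that join different eigenspaces of S, and on
these K is the constant b; hence R.S = b Q(g, S) ([diag_curv_pseudosymmetric]).
A combination T of g/\g, g/\S and S/\S is a polynomial in g and S for the
Kulkarni-Nomizu product, on which derivations satisfy the Leibniz rule, so that
R.T = b Q(g, T) ([curv_dot_kn_poly]).  Both R and C are such combinations: R
because K(k, i) = 2 varrho1 + varrho2 (s_k + s_i) + 2 varrho3 s_k s_i, and C
because it differs from R by multiples of g/\g and g/\S.  This gives (i) and
(ii).  The Weyl operator is diagonal too, with a constant mixed value again, and
the same argument gives (iii) and (iv).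

For (v), the identity Q(S, g) = - Q(g, S) turns each of Q(g, R), Q(S, R) and
Q(g, C) into a combination of g/\Q(g, S) and S/\Q(g, S); the claim amounts to
the equality of two pairs of coefficients ([tachibana_kn_poly_swap]).

The values of K are computed for a general static metric
- f dt^2 + f^-1 d rho^2 + rho^2 (d theta^2 + sin^2 theta d phi^2):
they are a = f''/2, b = f'/(2 rho) and d = (f - 1)/rho^2
([riemann_op_static]).
*)

(** * Four-element index sets *)

Lemma ord4P (P : 'I_4 -> Prop) : P 0 -> P 1 -> P 2 -> P 3 -> forall i, P i.
Proof.
move=> P0 P1 P2 P3 [[|[|[|[|//]]]] i4].
- by rewrite (_ : Ordinal i4 = 0); last exact: val_inj.
- by rewrite (_ : Ordinal i4 = 1); last exact: val_inj.
- by rewrite (_ : Ordinal i4 = 2); last exact: val_inj.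
- by rewrite (_ : Ordinal i4 = 3); last exact: val_inj.
Qed.

Lemma sum_ord4 (V : nmodType) (F : 'I_4 -> V) : \sum_i F i = F 0 + F 1 + F 2 + F 3.
Proof.
rewrite 4!big_ord_recl big_ord0 addr0 !addrA.
have -> : lift ord0 (lift ord0 ord0) = 2 :> 'I_4 by apply: val_inj.
have -> : lift ord0 (lift ord0 (lift ord0 ord0)) = 3 :> 'I_4 by apply: val_inj.
by have -> : lift ord0 ord0 = 1 :> 'I_4 by apply: val_inj.
Qed.

(** * Derivations of Kulkarni-Nomizu polynomials *)

Section PairDerivation.
Set Implicit Arguments.
Unset Strict Implicit.
Variables (R : realType) (n : nat).
Implicit Types (u v w x : 'rV[R]_n) (tau lam : 'rV[R]_n -> 'rV[R]_n -> R).
Implicit Types (A : 'rV[R]_n -> 'rV[R]_n) (eta : tensor R n 4).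

(** [derivation] for (0,2)-tensors, which are curried functions rather than
    functions of a family of two vectors. *)
Definition pair_derivation A tau u v : R := - (tau (A u) v + tau u (A v)).

Lemma derivation4E A eta (z : 'I_4 -> 'rV[R]_n) :
  derivation A eta z = - (
    eta (@dfwith 'I_4 (fun=> 'rV[R]_n) z 0 (A (z 0))) +
    eta (@dfwith 'I_4 (fun=> 'rV[R]_n) z 1 (A (z 1))) +
    eta (@dfwith 'I_4 (fun=> 'rV[R]_n) z 2 (A (z 2))) +
    eta (@dfwith 'I_4 (fun=> 'rV[R]_n) z 3 (A (z 3)))).
Proof. by rewrite /derivation sum_ord4. Qed.

(** The Leibniz rule: each term of the product is a value of tau times a value of
    lam, and the four arguments are shared out between the two factors. *)
Lemma derivation_kulkarni_nomizu A tau lam z :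
  derivation A (kulkarni_nomizu tau lam) z =
  kulkarni_nomizu (pair_derivation A tau) lam z +
  kulkarni_nomizu tau (pair_derivation A lam) z.
Proof.
rewrite derivation4E /kulkarni_nomizu /pair_derivation.
by rewrite !dfwithin !dfwithout //; ring.
Qed.

Lemma kulkarni_nomizuC tau lam :
  kulkarni_nomizu tau lam = kulkarni_nomizu lam tau.
Proof. by apply/funext => z; rewrite /kulkarni_nomizu; ring. Qed.

Lemma kulkarni_nomizuZl (k : R) tau lam z :
  kulkarni_nomizu (fun u v => k * tau u v) lam z = k * kulkarni_nomizu tau lam z.
Proof. by rewrite /kulkarni_nomizu; ring. Qed.

Definition kn_poly (al be ga : R) G S : tensor R n 4 := fun z =>
  al * kulkarni_nomizu G G z + be * kulkarni_nomizu G S z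
  + ga * kulkarni_nomizu S S z.

(** The derivation reaches G and S only through the Leibniz rule; the factors 2
    come from the symmetry of the Kulkarni-Nomizu product. *)
Lemma derivation_kn_poly A al be ga G S z :
  derivation A (kn_poly al be ga G S) z =
    (2 * al) * kulkarni_nomizu (pair_derivation A G) G z
  + be * (kulkarni_nomizu (pair_derivation A G) S z
          + kulkarni_nomizu (pair_derivation A S) G z)
  + (2 * ga) * kulkarni_nomizu (pair_derivation A S) S z.
Proof.
transitivity (al * derivation A (kulkarni_nomizu G G) z
  + be * derivation A (kulkarni_nomizu G S) z
  + ga * derivation A (kulkarni_nomizu S S) z).
  by rewrite !derivation4E /kn_poly; ring.
rewrite !derivation_kulkarni_nomizu.
rewrite ![kulkarni_nomizu _ (pair_derivation _ _)]kulkarni_nomizuC.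
by ring.
Qed.

(** Pseudosymmetry passes from S to every Kulkarni-Nomizu polynomial in G and S,
    because a derivation that kills G is determined by its value on S. *)
Lemma curv_dot_kn_poly (mu : 'rV[R]_n -> 'rV[R]_n -> 'rV[R]_n -> 'rV[R]_n)
    (L al be ga : R) G S z X Y :
    pair_derivation (mu X Y) G = (fun _ _ => 0) ->
    pair_derivation (wedge_op G X Y) G = (fun _ _ => 0) ->
    pair_derivation (mu X Y) S =
      (fun u v => L * pair_derivation (wedge_op G X Y) S u v) ->
  curv_dot mu (kn_poly al be ga G S) z X Y =
  L * tachibana G (kn_poly al be ga G S) z X Y.
Proof.
rewrite /curv_dot /tachibana !derivation_kn_poly => -> -> ->.
by rewrite !kulkarni_nomizuZl /kulkarni_nomizu; ring.
Qed.

(** All three Tachibana tensors lie in the span of the products of G and of S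
    with Q(G, S), as Q(G, G) and Q(S, S) vanish and Q(S, G) = - Q(G, S).  The two
    hypotheses on scalars compare the coefficients. *)
Lemma tachibana_kn_poly_swap (L rho al be ga be' al' : R) G S z X Y :
    pair_derivation (wedge_op G X Y) G = (fun _ _ => 0) ->
    pair_derivation (wedge_op S X Y) S = (fun _ _ => 0) ->
    pair_derivation (wedge_op S X Y) G =
      (fun u v => - 1 * pair_derivation (wedge_op G X Y) S u v) ->
    L * be = - (2 * al) + rho * be' ->
    L * (2 * ga) = - be + rho * (2 * ga) ->
  L * tachibana G (kn_poly al be ga G S) z X Y =
  tachibana S (kn_poly al be ga G S) z X Y
  + rho * tachibana G (kn_poly al' be' ga G S) z X Y.
Proof.
rewrite /tachibana !derivation_kn_poly => -> -> -> e1 e2.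
rewrite !kulkarni_nomizuZl.
have k0 lam : kulkarni_nomizu (fun _ _ => 0) lam z = 0.
  by rewrite /kulkarni_nomizu !mul0r; ring.
rewrite !k0.
set K1 := kulkarni_nomizu _ G z; set K2 := kulkarni_nomizu _ S z.
transitivity ((L * be) * K1 + (L * (2 * ga)) * K2); first by ring.
by rewrite e1 e2; ring.
Qed.

End PairDerivation.

(** * Diagonal curvature operators *)

Section DiagonalCurvature.
Set Implicit Arguments.
Unset Strict Implicit.
Variables (R : realType) (n : nat).
Implicit Types (u v w x : 'rV[R]_n) (c d s : 'I_n -> R) (K : 'I_n -> 'I_n -> R).

Definition diag_form c u v : R := \sum_i c i * (u 0 i * v 0 i).

(** The sum over pairs (k, i) of K k i times the elementary rotation of the plane
    (k, i); with K constant equal to 1 it is [wedge_op (diag_form c)]. *)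
Definition diag_curv c K u v w : 'rV[R]_n :=
  \row_k \sum_i K k i * c i * (v 0 i * w 0 i * u 0 k - u 0 i * w 0 i * v 0 k).

Lemma diag_formM c d u v w x :
  diag_form c u v * diag_form d w x =
  \sum_k \sum_i c k * d i * (u 0 k * v 0 k * (w 0 i * x 0 i)).
Proof.
rewrite /diag_form big_distrlr /=; apply: eq_bigr => k _.
by apply: eq_bigr => i _; ring.
Qed.

(** The rotation of the degenerate plane (k, k) is zero. *)
Lemma eq_diag_curv c K K' : (forall k i, k != i -> K k i = K' k i) ->
  diag_curv c K = diag_curv c K'.
Proof.
move=> eqK; apply/funext => u; apply/funext => v; apply/funext => w.
apply/rowP => k; rewrite !mxE; apply: eq_bigr => i _.
by have [->|ki] := eqVneq k i; [ring | rewrite eqK].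
Qed.

Lemma wedge_op_diag c u v w :
  wedge_op (diag_form c) u v w = diag_curv c (fun _ _ => 1) u v w.
Proof.
apply/rowP => k; rewrite !mxE /diag_form !mulr_suml -sumrB.
by apply: eq_bigr => i _; ring.
Qed.

(** Q(c, d) = - Q(d, c): both sides are made of the same four products of a value
    of c and a value of d. *)
Lemma pair_derivation_wedgeC c d X Y u v :
  pair_derivation (wedge_op (diag_form c) X Y) (diag_form d) u v =
  - 1 * pair_derivation (wedge_op (diag_form d) X Y) (diag_form c) u v.
Proof.
have lin e a x b y w : diag_form e (a *: x - b *: y) w =
    a * diag_form e x w - b * diag_form e y w.
  by rewrite /diag_form !mulr_sumr -sumrB; apply: eq_bigr => i _; rewrite !mxE; ring.
have sym e x y : diag_form e x y = diag_form e y x.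
  by apply: eq_bigr => i _; ring.
rewrite /pair_derivation /wedge_op !(sym _ u (_ - _)) !lin.
by ring.
Qed.

Lemma pair_derivation_wedge_self c X Y :
  pair_derivation (wedge_op (diag_form c) X Y) (diag_form c) = (fun _ _ => 0).
Proof.
apply/funext => u; apply/funext => v.
by have := pair_derivation_wedgeC c c X Y u v; lra.
Qed.

Lemma pair_derivation_diag c d K X Y u v :
  pair_derivation (diag_curv c K X Y) (diag_form d) u v =
  - \sum_k \sum_i d k * c i * K k i *
      (Y 0 i * u 0 i * X 0 k * v 0 k - X 0 i * u 0 i * Y 0 k * v 0 k +
       (Y 0 i * v 0 i * X 0 k * u 0 k - X 0 i * v 0 i * Y 0 k * u 0 k)).
Proof.
rewrite /pair_derivation /diag_form -big_split /=; congr (- _).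
apply: eq_bigr => k _; rewrite !mxE mulr_suml mulr_sumr mulr_sumr mulr_sumr -big_split /=.
by apply: eq_bigr => i _; ring.
Qed.

Lemma sum_antisym (T : 'I_n -> 'I_n -> R) :
  (forall k i, T k i = - T i k) -> \sum_k \sum_i T k i = 0.
Proof.
move=> asym; have : \sum_k \sum_i T k i = - \sum_k \sum_i T k i.
  rewrite [LHS]exchange_big /= -sumrN; apply: eq_bigr => k _.
  by rewrite -sumrN; apply: eq_bigr => i _.
by lra.
Qed.

(** The rotation of the plane (k, i) sees diag_form (c s) only through
    s k - s i.  Hence K k i matters only where s k != s i, and if it equals b
    there, the operator acts as b times the one with constant K. *)
Lemma diag_curv_pseudosymmetric c s K (b : R) X Y :
    (forall k i, K k i = K i k) ->
    (forall k i, s k != s i -> K k i = b) ->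
  pair_derivation (diag_curv c K X Y) (diag_form (fun i => c i * s i)) =
  (fun u v => b * pair_derivation (wedge_op (diag_form c) X Y)
                    (diag_form (fun i => c i * s i)) u v).
Proof.
move=> symK Kb; apply/funext => u; apply/funext => v.
have -> : wedge_op (diag_form c) X Y = diag_curv c (fun _ _ => 1) X Y.
  by apply/funext => w; rewrite wedge_op_diag.
apply/eqP; rewrite -subr_eq0 !pair_derivation_diag mulrN -opprD oppr_eq0 mulr_sumr.
rewrite -sumrB; under eq_bigr do rewrite mulr_sumr -sumrB.
apply/eqP/sum_antisym => k i; have [ski|/Kb Kkib] := eqVneq (s k) (s i).
  by rewrite ski (symK i k); ring.
by rewrite (symK i k) Kkib; ring.
Qed.

Lemma diag_curv_skew c K X Y : (forall k i, K k i = K i k) ->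
  pair_derivation (diag_curv c K X Y) (diag_form c) = (fun _ _ => 0).
Proof.
move=> symK.
have -> : diag_form c = diag_form (fun i => c i * 1).
  by congr diag_form; apply/funext => i; rewrite mulr1.
rewrite (@diag_curv_pseudosymmetric _ _ _ 0) // => [|k i]; last by rewrite eqxx.
by apply/funext => u; apply/funext => v; rewrite mul0r.
Qed.

Lemma kulkarni_nomizu_diag c d (z : 'I_4 -> 'rV[R]_n) :
  kulkarni_nomizu (diag_form c) (diag_form d) z =
  \sum_k \sum_i (c k * d i + d k * c i) *
    (z 0 0 k * z 3 0 k * (z 1 0 i * z 2 0 i) -
     z 0 0 i * z 2 0 i * (z 1 0 k * z 3 0 k)).
Proof.
rewrite /kulkarni_nomizu !diag_formM.
rewrite [X in _ - X + _ - _]exchange_big [X in _ + X - _]exchange_big /=.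
rewrite -sumrB -big_split -sumrB /=; apply: eq_bigr => k _.
rewrite -sumrB -big_split -sumrB /=; apply: eq_bigr => i _.
by ring.
Qed.

(** The products of the diagonal forms of c and c s have the operator coefficients
    2, s k + s i and 2 s k s i on the plane (k, i). *)
Lemma lower_diag_curv c s K (al be ga : R) :
    (forall k i, k != i ->
      K k i = 2 * al + be * (s k + s i) + 2 * ga * (s k * s i)) ->
  (fun z : 'I_4 -> 'rV[R]_n =>
     diag_form c (diag_curv c K (z 0) (z 1) (z 2)) (z 3)) =
  kn_poly al be ga (diag_form c) (diag_form (fun i => c i * s i)).
Proof.
move=> /eq_diag_curv ->; apply/funext => z.
rewrite /kn_poly !kulkarni_nomizu_diag !mulr_sumr -!big_split /=.
apply: eq_bigr => k _; rewrite !mxE mulr_suml !mulr_sumr -!big_split /=.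
by apply: eq_bigr => i _; ring.
Qed.

Lemma trace_diag_curv c K u v :
  trace_op (fun z => diag_curv c K z u v) =
  diag_form (fun i => c i * \sum_(k | k != i) K k i) u v.
Proof.
rewrite /trace_op /diag_form.
under eq_bigr do rewrite !mxE.
rewrite exchange_big /=; apply: eq_bigr => i _.
rewrite (bigD1 i) //= mulr_sumr mulr_suml.
rewrite [X in X + _ = _](_ : _ = 0) ?add0r; last first.
  by rewrite !mxE !eqxx /=; ring.
by apply: eq_bigr => k ki; rewrite !mxE !eqxx /= [i == k]eq_sym (negPf ki) /=; ring.
Qed.

Lemma sum_wedge_op_diag c s u v w :
  let J x := \row_i (s i * x 0 i) : 'rV[R]_n in
  wedge_op (diag_form c) u (J v) w + wedge_op (diag_form c) (J u) v w =
  diag_curv c (fun k i => s k + s i) u v w.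
Proof.
apply/rowP => k; rewrite !mxE /diag_form !mulr_suml -!sumrB -big_split /=.
by apply: eq_bigr => i _; rewrite !mxE; ring.
Qed.

End DiagonalCurvature.

(** * Ricci and Weyl curvature of a diagonal metric *)

Section DiagonalMetric.
Set Implicit Arguments.
Unset Strict Implicit.
Variables (R : realType) (n : nat) (g : 'rV[R]_n -> 'M[R]_n) (p : 'rV[R]_n).
Variable c : 'I_n -> R.
Hypothesis gE : g p = diag_mx (\row_i c i).
Hypothesis c_neq0 : forall i, c i != 0.

Lemma metric_diag : metric g p = diag_form c.
Proof.
apply/funext => u; apply/funext => v.
rewrite /metric gE mxE; apply: eq_bigr => i _.
by rewrite mul_mx_diag !mxE; ring.
Qed.

Lemma invmx_metric_diag : invmx (g p) = diag_mx (\row_i (c i)^-1).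
Proof.
have gV : g p *m diag_mx (\row_i (c i)^-1) = 1%:M.
  apply/matrixP => i j; rewrite gE mul_diag_mx !mxE.
  by case: eqVneq => [->|]; rewrite ?mulr0 // divff.
have gU : g p \in unitmx by case: (mulmx1_unit gV).
by rewrite -[RHS](mulKmx gU) gV mulmx1.
Qed.

Variable K : 'I_n -> 'I_n -> R.
Hypothesis riemannE : riemann_op g p = diag_curv c K.

Definition ricci_eigenvalue (i : 'I_n) : R := \sum_(k | k != i) K k i.

Lemma ricci_diag : ricci g p = diag_form (fun i => c i * ricci_eigenvalue i).
Proof.
apply/funext => u; apply/funext => v.
by rewrite /ricci riemannE trace_diag_curv.
Qed.

Lemma ricci_op_diag v : ricci_op g p v = \row_i (ricci_eigenvalue i * v 0 i).
Proof.
apply/rowP => i; rewrite /ricci_op invmx_metric_diag mul_mx_diag !mxE.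
rewrite ricci_diag /diag_form (bigD1 i) //= big1 ?addr0 => [|j ji].
  by rewrite !mxE !eqxx /=; field.
by rewrite !mxE (negPf ji) /= mul0r mulr0.
Qed.

Lemma scalar_curvature_diag :
  scalar_curvature g p = \sum_i ricci_eigenvalue i.
Proof.
apply: eq_bigr => i _.
by rewrite ricci_op_diag !mxE !eqxx mulr1.
Qed.

Lemma weyl_op_diag : weyl_op g p = diag_curv c (fun k i =>
  K k i - (n%:R - 2)^-1 * (ricci_eigenvalue k + ricci_eigenvalue i)
  + scalar_curvature g p / ((n%:R - 1) * (n%:R - 2))).
Proof.
apply/funext => u; apply/funext => v; apply/funext => w.
rewrite /weyl_op metric_diag !ricci_op_diag sum_wedge_op_diag wedge_op_diag riemannE.
apply/rowP => k; rewrite !mxE !mulr_sumr -sumrN -!big_split /=.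
by apply: eq_bigr => i _; ring.
Qed.

End DiagonalMetric.

Section RoterDiagonal.
Set Implicit Arguments.
Unset Strict Implicit.
Variables (R : realType) (n : nat) (g : 'rV[R]_n -> 'M[R]_n) (p : 'rV[R]_n).
Variables (c : 'I_n -> R) (K : 'I_n -> 'I_n -> R).
Hypothesis gE : g p = diag_mx (\row_i c i).
Hypothesis c_neq0 : forall i, c i != 0.
Hypothesis riemannE : riemann_op g p = diag_curv c K.
Let s := ricci_eigenvalue K.

Lemma riemann_roter (al be ga : R) :
    (forall k i, k != i ->
      K k i = 2 * al + be * (s k + s i) + 2 * ga * (s k * s i)) ->
  riemann g p = kn_poly al be ga (metric g p) (ricci g p).
Proof.
move=> KE; rewrite (metric_diag gE) (ricci_diag riemannE) -(lower_diag_curv _ KE).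
by apply/funext => z; rewrite /riemann /lower_op riemannE (metric_diag gE).
Qed.

(** Passing from R to C changes only the coefficients of g/\g and g/\S. *)
Lemma weyl_roter (al be ga : R) :
    (forall k i, k != i ->
      K k i = 2 * al + be * (s k + s i) + 2 * ga * (s k * s i)) ->
  weyl g p = kn_poly (al + scalar_curvature g p / (2 * ((n%:R - 1) * (n%:R - 2))))
    (be - (n%:R - 2)^-1) ga (metric g p) (ricci g p).
Proof.
move=> KE; rewrite (metric_diag gE) (ricci_diag riemannE).
rewrite -(@lower_diag_curv _ _ c s (fun k i => K k i - (n%:R - 2)^-1 * (s k + s i)
    + scalar_curvature g p / ((n%:R - 1) * (n%:R - 2)))); last first.
  move=> k i /KE ->; rewrite [(2 * (_ * _))^-1]invfM.
  by set X := (_ * (_ - 2))^-1; set Y := (_ - 2)^-1; field.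
apply/funext => z.
by rewrite /weyl /lower_op (weyl_op_diag gE c_neq0 riemannE) (metric_diag gE).
Qed.

(** Used with mu the Riemann operator and with mu the Weyl operator: both are
    diagonal in the basis that diagonalizes the Ricci operator. *)
Lemma curv_dot_roter (mu : 'rV[R]_n -> 'rV[R]_n -> 'rV[R]_n -> 'rV[R]_n)
    (K' : 'I_n -> 'I_n -> R) (L al be ga : R) z X Y :
    mu = diag_curv c K' -> (forall k i, K' k i = K' i k) ->
    (forall k i, s k != s i -> K' k i = L) ->
  let T := kn_poly al be ga (metric g p) (ricci g p) in
  curv_dot mu T z X Y = L * tachibana (metric g p) T z X Y.
Proof.
move=> -> K'sym K'L /=; rewrite (metric_diag gE) (ricci_diag riemannE).
apply: curv_dot_kn_poly.
- exact: diag_curv_skew.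
- exact: pair_derivation_wedge_self.
- exact: diag_curv_pseudosymmetric.
Qed.

Lemma tachibana_roter_swap (L rho al be ga be' al' : R) z X Y :
    L * be = - (2 * al) + rho * be' ->
    L * (2 * ga) = - be + rho * (2 * ga) ->
  let G := metric g p in let S := ricci g p in
  L * tachibana G (kn_poly al be ga G S) z X Y =
  tachibana S (kn_poly al be ga G S) z X Y
  + rho * tachibana G (kn_poly al' be' ga G S) z X Y.
Proof.
rewrite (metric_diag gE) (ricci_diag riemannE) => e1 e2 /=.
apply: tachibana_kn_poly_swap e1 e2.
- exact: pair_derivation_wedge_self.
- exact: pair_derivation_wedge_self.
by apply/funext => u; apply/funext => v; rewrite pair_derivation_wedgeC.
Qed.

End RoterDiagonal.

Section BlockCurvature.
Set Implicit Arguments.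
Unset Strict Implicit.
Variables (R : realType) (a b d : R).

(** Coordinates 0, 1 are t, rho and coordinates 2, 3 are the angles. *)
Definition block_curv (k i : 'I_4) : R :=
  if (k < 2)%N != (i < 2)%N then b else if (k < 2)%N then a else d.

Lemma block_curv_sym k i : block_curv k i = block_curv i k.
Proof. by rewrite /block_curv; case: (k < 2)%N; case: (i < 2)%N. Qed.

Lemma ricci_eigenvalue_block i :
  ricci_eigenvalue (block_curv) i =
  if (i < 2)%N then a + 2 * b else d + 2 * b.
Proof.
rewrite /ricci_eigenvalue big_mkcond sum_ord4 /block_curv.
by elim/ord4P: i => /=; ring.
Qed.

(** Different Ricci eigenvalues occur only across the two blocks. *)
Lemma block_curv_mixed k i :
    ricci_eigenvalue (block_curv) k != ricci_eigenvalue (block_curv) i ->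
  block_curv k i = b.
Proof.
by rewrite !ricci_eigenvalue_block /block_curv; case: ifP; case: ifP; rewrite ?eqxx.
Qed.

Lemma block_curv_roter (al be ga : R) :
    let s1 := a + 2 * b in let s2 := d + 2 * b in
    a = 2 * al + be * (s1 + s1) + 2 * ga * (s1 * s1) ->
    b = 2 * al + be * (s1 + s2) + 2 * ga * (s1 * s2) ->
    d = 2 * al + be * (s2 + s2) + 2 * ga * (s2 * s2) ->
  forall k i, block_curv k i = 2 * al
    + be * (ricci_eigenvalue (block_curv) k
            + ricci_eigenvalue (block_curv) i)
    + 2 * ga * (ricci_eigenvalue (block_curv) k
                * ricci_eigenvalue (block_curv) i).
Proof.
move=> s1 s2 ea eb ed k i; rewrite !ricci_eigenvalue_block /block_curv.
case: (k < 2)%N; case: (i < 2)%N => //=.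
by rewrite [s2 + s1]addrC [s2 * s1]mulrC.
Qed.

End BlockCurvature.

(** * Curvature in a chart, in terms of Christoffel symbols *)

Section Chart.
Set Implicit Arguments.
Unset Strict Implicit.
Variables (R : realType) (n : nat) (g : 'rV[R]_n -> 'M[R]_n).
Implicit Types (p u v w : 'rV[R]_n).

(** The covariant derivative of the constant field w along v. *)
Definition christoffel_form p v w : 'rV[R]_n :=
  \row_k \sum_i \sum_j christoffel g p k i j * v 0 i * w 0 j.

Lemma nabla_cst v w : nabla g (cst v) (cst w) = fun q => christoffel_form q v w.
Proof.
apply/funext => q; apply/rowP => k.
by rewrite !mxE derive_cst add0r.
Qed.

(** Constant fields commute, so the bracket term drops and the curvature is the
    derivative of the Christoffel form plus its commutator. *)
Lemma riemann_opE p u v w (Du Dv : 'rV[R]_n) :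
    (forall k, is_derive p u (fun q => christoffel_form q v w 0 k) (Du 0 k)) ->
    (forall k, is_derive p v (fun q => christoffel_form q u w 0 k) (Dv 0 k)) ->
  riemann_op g p u v w =
  - (Du - Dv + christoffel_form p u (christoffel_form p v w)
     - christoffel_form p v (christoffel_form p u w)).
Proof.
move=> dDu dDv.
have bracket0 : lie_bracket (cst u) (cst v) = cst 0.
  by apply/funext => q; apply/rowP => k; rewrite !mxE !derive_cst subrr.
rewrite /riemann_op /curvature_field bracket0 !nabla_cst; congr (- _).
apply/rowP => k; rewrite !mxE.
rewrite [X in _ - _ - X](_ : _ = 0) ?subr0; last first.
  by apply: big1 => i _; apply: big1 => j _; rewrite mxE mulr0 mul0r.
have := @derive_val _ _ _ _ _ _ _ (dDu k); have := @derive_val _ _ _ _ _ _ _ (dDv k).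
rewrite /= => -> ->.
by ring.
Qed.

End Chart.

Section DiagonalChart.
Set Implicit Arguments.
Unset Strict Implicit.
Variables (R : realType) (n : nat) (c : 'rV[R]_n -> 'I_n -> R).
Let g q := diag_mx (\row_i c q i).
Variables (p : 'rV[R]_n) (dc : 'I_n -> 'I_n -> R).
Hypothesis c_neq0 : forall i, c p i != 0.
Hypothesis dcE : forall a k, partial a (fun q => c q k) p = dc a k.

(** In a diagonal metric only the index l = k survives in the Christoffel symbol
    Gamma^k_ij, which involves three partial derivatives of coefficients:
    dc i k if j = k, dc j k if i = k, and dc k i if i = j. *)
Lemma christoffel_form_diag v w : christoffel_form g p v w =
  \row_k ((2 * c p k)^-1 * (\sum_a dc a k * (v 0 a * w 0 k + v 0 k * w 0 a)
                            - \sum_a dc k a * (v 0 a * w 0 a))).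
Proof.
have dg a i j : partial a (fun q => g q i j) p = dc a i *+ (i == j).
  rewrite /g; case: eqVneq => [->|ij]; last first.
    rewrite /partial (_ : (fun q => _) = cst 0) ?derive_cst //.
    by apply/funext => q; rewrite !mxE (negPf ij).
  by rewrite -dcE; congr (partial _ _ _); apply/funext => q; rewrite !mxE eqxx.
have chrE k i j : christoffel g p k i j =
    (2 * c p k)^-1 * (dc i j *+ (j == k) + dc j i *+ (i == k) - dc k i *+ (i == j)).
  rewrite /christoffel (@invmx_metric_diag _ _ g p (c p)) // invfM -mulrA.
  congr (_ * _); rewrite (bigD1 k) //= big1 ?addr0 => [|l lk].
    by rewrite !mxE eqxx !dg.
  by rewrite !mxE [k == l]eq_sym (negPf lk) mul0r.
apply/rowP => k; rewrite !mxE.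
have pick (F : 'I_n -> R) j : \sum_i F i *+ (i == j) = F j.
  rewrite (bigD1 j) //= eqxx big1 ?addr0 // => i /negPf -> //.
transitivity (\sum_i \sum_j (2 * c p k)^-1 *
   ((dc i j * v 0 i * w 0 j) *+ (j == k) + (dc j i * v 0 i * w 0 j) *+ (i == k)
   - (dc k i * v 0 i * w 0 j) *+ (j == i))).
  apply: eq_bigr => i _; apply: eq_bigr => j _; rewrite chrE.
  rewrite [j == i]eq_sym; case: (j == k); case: (i == k); case: (i == j);
    by rewrite ?mulr1n ?mulr0n; ring.
under eq_bigr do rewrite -mulr_sumr sumrB big_split /= !pick.
rewrite -mulr_sumr sumrB big_split /=; congr (_ * (_ - _)); last first.
  by apply: eq_bigr => i _; rewrite mulrA.
under [X in _ + X = _]eq_bigr do rewrite sumrMnl.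
rewrite pick -big_split /=; apply: eq_bigr => i _; ring.
Qed.

End DiagonalChart.

(** * Derivatives of functions of the coordinates *)

Section Coordinates.
Set Implicit Arguments.
Unset Strict Implicit.
Variables (R : realType) (n : nat).
Implicit Types (p u : 'rV[R]_n).

Lemma is_derive_line (F : 'rV[R]_n -> R) p u (d : R) :
  is_derive (0 : R) 1 (fun h => F (h *: u + p)) d -> is_derive p u F d.
Proof.
move=> [Fd dE]; split; first exact: (derivable1P F p u).2 Fd.
rewrite -dE /derive; set q1 := fun h => h^-1 *: _; set q2 := fun h => h^-1 *: _.
suff -> : q1 = q2 by []; apply/funext => h; rewrite /q1 /q2 /=.
by rewrite addr0 scale0r add0r [_%:A]mulr1.
Qed.

Lemma is_derive_coord (F : R -> R) (dF : R) i p u :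
    is_derive (p 0 i) 1 F dF ->
  is_derive p u (fun q => F (q 0 i)) (u 0 i * dF).
Proof.
move=> FdF; apply: is_derive_line.
have -> : (fun h => F ((h *: u + p) 0 i)) = F \o (fun h => h * u 0 i + p 0 i).
  by apply/funext => h; rewrite /= !mxE.
rewrite mulrC; apply: is_derive1_comp; first by rewrite mul0r add0r.
have -> : (fun h => h * u 0 i + p 0 i) = id * cst (u 0 i) + cst (p 0 i).
  by apply/funext.
apply: is_derive_eq.
by rewrite scaler0 add0r addr0 [_%:A]mulr1.
Qed.

(** Every metric coefficient and Christoffel symbol below has this shape, with i
    the radial coordinate and j the polar angle. *)
Lemma is_derive_coord2 (F G H : R -> R) (dF dG dH : R) i j p u :
    is_derive (p 0 i) 1 F dF -> is_derive (p 0 i) 1 G dG ->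
    is_derive (p 0 j) 1 H dH ->
  is_derive p u (fun q => F (q 0 i) + G (q 0 i) * H (q 0 j))
    (u 0 i * (dF + dG * H (p 0 j)) + u 0 j * (G (p 0 i) * dH)).
Proof.
move=> /(@is_derive_coord _ _ i p u) FD /(@is_derive_coord _ _ i p u) GD.
move=> /(@is_derive_coord _ _ j p u) HD.
have := is_deriveD FD (is_deriveM GD HD).
by move/is_derive_eq; apply; rewrite /GRing.scale /=; ring.
Qed.

Lemma near_neq0 (h : R -> R) (x d : R) : is_derive x 1 h d -> h x != 0 ->
  \forall y \near x, h y != 0.
Proof.
move=> hD hx0; have hx : h @ x --> h x.
  by apply/differentiable_continuous/derivable1_diffP; exact: ex_derive.
exact: cvgr_neq0 hx hx0.
Qed.

Lemma near_coord (P : R -> Prop) i p :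
  (\forall x \near p 0 i, P x) -> \forall q \near p, P ((q : 'rV[R]_n) 0 i).
Proof. exact: (@coord_continuous _ _ _ 0 i p). Qed.

End Coordinates.

(** * Static spherically symmetric metrics *)

Section StaticSpherical.
Set Implicit Arguments.
Unset Strict Implicit.
Variables (R : realType) (f f1 : R -> R).
Implicit Types (q u v w : 'rV[R]_4).

Definition static_coef q (i : 'I_4) : R :=
  [:: - f (q 0 1); (f (q 0 1))^-1; q 0 1 ^+ 2; q 0 1 ^+ 2 * sin (q 0 2) ^+ 2]`_i.

Definition static_metric q : 'M[R]_4 := diag_mx (\row_i static_coef q i).

(** f1 stands for the derivative of f. *)
Definition static_christoffel q v w : 'rV[R]_4 :=
  let r := q 0 1 in let s := sin (q 0 2) in let c := cos (q 0 2) in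
  \row_k [::
    f1 r / f r / 2 * (v 0 0 * w 0 1 + v 0 1 * w 0 0);
    f r * f1 r / 2 * (v 0 0 * w 0 0) - f1 r / f r / 2 * (v 0 1 * w 0 1)
      - r * f r * (v 0 2 * w 0 2 + s ^+ 2 * (v 0 3 * w 0 3));
    r^-1 * (v 0 1 * w 0 2 + v 0 2 * w 0 1) - s * c * (v 0 3 * w 0 3);
    r^-1 * (v 0 1 * w 0 3 + v 0 3 * w 0 1)
      + c / s * (v 0 2 * w 0 3 + v 0 3 * w 0 2)]`_k.

Lemma is_derive_sin2 (x : R) : is_derive x 1 (fun t => sin t ^+ 2) (2 * sin x * cos x).
Proof.
have -> : (fun t => sin t ^+ 2 : R) = sin ^+ 2 by apply/funext.
by apply: is_derive_eq; rewrite /GRing.scale /=; ring.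
Qed.

Lemma is_derive_sqr (x : R) : is_derive x 1 (fun t => t ^+ 2) (2 * x).
Proof.
have -> : (fun t => t ^+ 2 : R) = id ^+ 2 by apply/funext.
by apply: is_derive_eq; rewrite /GRing.scale /=; ring.
Qed.

Lemma is_derive_sincos (x : R) :
  is_derive x 1 (fun t => sin t * cos t) (cos x ^+ 2 - sin x ^+ 2).
Proof.
have -> : (fun t => sin t * cos t : R) = sin * cos by apply/funext.
by apply: is_derive_eq; rewrite /GRing.scale /=; ring.
Qed.

(** With 1 + cot^2 in place of 1 / sin^2, the powers of cos cancel in the
    curvature by rational simplification alone. *)
Lemma is_derive_cot (x : R) : sin x != 0 ->
  is_derive x 1 (fun t => cos t / sin t) (- (1 + cos x ^+ 2 / sin x ^+ 2)).
Proof.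
move=> s0.
have sV := @is_deriveV _ sin x (cos x) 1 s0 (is_derive_sin x).
have := is_deriveM (is_derive_cos x) sV.
by move/is_derive_eq; apply; rewrite /GRing.scale /=; field.
Qed.

Lemma is_derive_static_coef q u k : f (q 0 1) != 0 ->
    is_derive (q 0 1) 1 f (f1 (q 0 1)) ->
  let r := q 0 1 in let s := sin (q 0 2) in let c := cos (q 0 2) in
  is_derive q u (fun q' => static_coef q' k)
    (u 0 1 * [:: - f1 r; - f1 r / f r ^+ 2; 2 * r; 2 * r * s ^+ 2]`_k
     + u 0 2 * [:: 0; 0; 0; 2 * r ^+ 2 * s * c]`_k).
Proof.
move=> f0 fD r s c.
have fND : is_derive r 1 (fun x => - f x) (- f1 r) by exact: is_deriveN.
have fVD := is_deriveV f0 fD.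
have rD := is_derive_sqr r.
have cD (a x : R) : is_derive x 1 (cst a : R -> R) 0 by exact: is_derive_cst.
elim/ord4P: k; rewrite /static_coef /=.
- by apply: is_derive_eq (is_derive_coord u fND) _; ring.
- by apply: is_derive_eq (is_derive_coord u fVD) _; rewrite /GRing.scale /=; field.
- by apply: is_derive_eq (is_derive_coord u rD) _; ring.
- have := is_derive_coord2 u (cD 0 r) rD (is_derive_sin2 (q 0 2)).
  rewrite (_ : (fun q' : 'rV[R]_4 => _ + _) =
     fun q' => q' 0 1 ^+ 2 * sin (q' 0 2) ^+ 2); last by apply/funext => q' /=; ring.
  by move=> /is_derive_eq; apply; rewrite /s /c /r /=; ring.
Qed.

Lemma static_coef_neq0 q i : f (q 0 1) != 0 -> q 0 1 != 0 -> sin (q 0 2) != 0 ->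
  static_coef q i != 0.
Proof.
move=> f0 r0 s0; elim/ord4P: i; rewrite /static_coef /=.
- by rewrite oppr_eq0.
- by rewrite invr_eq0.
- by rewrite expf_neq0.
- by rewrite mulf_neq0 ?expf_neq0.
Qed.

Lemma christoffel_form_static q v w : f (q 0 1) != 0 -> q 0 1 != 0 ->
    sin (q 0 2) != 0 -> is_derive (q 0 1) 1 f (f1 (q 0 1)) ->
  christoffel_form static_metric q v w = static_christoffel q v w.
Proof.
move=> f0 r0 s0 fD.
pose dc (a k : 'I_4) : R := Defs.basis R a 0 1 *
    [:: - f1 (q 0 1); - f1 (q 0 1) / f (q 0 1) ^+ 2; 2 * q 0 1;
        2 * q 0 1 * sin (q 0 2) ^+ 2]`_k
  + Defs.basis R a 0 2 * [:: 0; 0; 0; 2 * q 0 1 ^+ 2 * sin (q 0 2) * cos (q 0 2)]`_k.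
rewrite (@christoffel_form_diag _ _ static_coef q dc); last 2 first.
- by move=> i; exact: static_coef_neq0.
- by move=> a k; have [_] := is_derive_static_coef (Defs.basis R a) k f0 fD.
apply/rowP => k; rewrite !mxE !sum_ord4 /dc /Defs.basis !mxE /static_coef.
by elim/ord4P: k => /=; field; rewrite ?f0 ?r0 ?s0.
Qed.

(** Curvature differentiates the Christoffel symbols, so their closed form has to
    hold on a neighbourhood of the point. *)
Lemma near_christoffel_form_static (p : 'rV[R]_4) :
    f (p 0 1) != 0 -> p 0 1 != 0 -> sin (p 0 2) != 0 ->
    (forall x : R, is_derive x 1 f (f1 x)) ->
  \forall q \near p, forall v w,
    christoffel_form static_metric q v w = static_christoffel q v w.
Proof.
move=> f0 r0 s0 fD.
have nf := near_coord (near_neq0 (fD _) f0).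
have nr := near_coord (near_neq0 (is_derive_id (p 0 1) 1) r0).
have ns := near_coord (near_neq0 (is_derive_sin (p 0 2)) s0).
near=> q => v w; apply: christoffel_form_static => //.
- by near: q.
- by near: q.
- by near: q.
Unshelve. all: by end_near. Qed.

(** The derivative at q, in the direction u, of the closed form above; f2 stands
    for the second derivative of f at the radius of q. *)
Definition static_christoffel_deriv q (f2 : R) u v w : 'rV[R]_4 :=
  let r := q 0 1 in let s := sin (q 0 2) in let c := cos (q 0 2) in
  \row_k [::
    u 0 1 * ((f2 * f r - f1 r ^+ 2) / (2 * f r ^+ 2)
             * (v 0 0 * w 0 1 + v 0 1 * w 0 0));
    u 0 1 * ((f1 r ^+ 2 + f r * f2) / 2 * (v 0 0 * w 0 0)
        - (f2 * f r - f1 r ^+ 2) / (2 * f r ^+ 2) * (v 0 1 * w 0 1)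
        - (f r + r * f1 r) * (v 0 2 * w 0 2 + s ^+ 2 * (v 0 3 * w 0 3)))
      - u 0 2 * (r * f r * (2 * s * c) * (v 0 3 * w 0 3));
    - u 0 1 * (r ^- 2 * (v 0 1 * w 0 2 + v 0 2 * w 0 1))
      - u 0 2 * ((c ^+ 2 - s ^+ 2) * (v 0 3 * w 0 3));
    - u 0 1 * (r ^- 2 * (v 0 1 * w 0 3 + v 0 3 * w 0 1))
      - u 0 2 * ((1 + c ^+ 2 / s ^+ 2) * (v 0 2 * w 0 3 + v 0 3 * w 0 2))]`_k.

Lemma is_derive_static_christoffel (p : 'rV[R]_4) (f2 : R) u v w k :
    f (p 0 1) != 0 -> p 0 1 != 0 -> sin (p 0 2) != 0 ->
    is_derive (p 0 1) 1 f (f1 (p 0 1)) -> is_derive (p 0 1) 1 f1 f2 ->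
  is_derive p u (fun q => static_christoffel q v w 0 k)
    (static_christoffel_deriv p f2 u v w 0 k).
Proof.
rewrite mxE; set r := p 0 1; set s := sin _; set c := cos _ => f0 r0 s0 fD f1D.
have cD (a x : R) : is_derive x 1 (cst a : R -> R) 0 by exact: is_derive_cst.
have fVD := is_deriveV f0 fD.
have rVD := @is_deriveV _ id r 1 1 r0 (is_derive_id r 1).
have rfD := is_deriveM (is_derive_id r 1) fD.
have ff1D := is_deriveM fD f1D.
have f1fD := is_deriveM f1D fVD.
(* Each component has the form F(rho) + G(rho) H(theta). *)
have split2 (F G H : R -> R) dF dG dH D (E : 'rV[R]_4 -> R) :
    is_derive r 1 F dF -> is_derive r 1 G dG -> is_derive (p 0 2) 1 H dH ->
    E = (fun q => F (q 0 1) + G (q 0 1) * H (q 0 2)) ->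
    u 0 1 * (dF + dG * H (p 0 2)) + u 0 2 * (G r * dH) = D ->
    is_derive p u E D.
  by move=> FD GD HD -> <-; exact: is_derive_coord2.
have Z (a : R) (F : R -> R) dF : is_derive r 1 F dF -> is_derive r 1 (a \*: F) (a *: dF).
  by move=> FD; exact: is_deriveZ.
elim/ord4P: k => /=.
- apply: (split2 _ _ _ _ _ _ _ _
    (Z (2^-1 * (v 0 0 * w 0 1 + v 0 1 * w 0 0)) _ _ f1fD) (cD 0 r) (cD 0 _)).
    by apply/funext => q; rewrite !mxE /= ?fctE /GRing.scale /= /GRing.scale /=; ring.
  by rewrite ?fctE /GRing.scale /= /GRing.scale /=; field.
- apply: (split2 _ _ _ _ _ _ _ _
    (is_deriveB (is_deriveB (Z (2^-1 * (v 0 0 * w 0 0)) _ _ ff1D)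
                  (Z (2^-1 * (v 0 1 * w 0 1)) _ _ f1fD))
                (Z (v 0 2 * w 0 2) _ _ rfD))
    (Z (- (v 0 3 * w 0 3)) _ _ rfD) (is_derive_sin2 _)).
    by apply/funext => q; rewrite !mxE /= ?fctE /GRing.scale /= /GRing.scale /=; ring.
  by rewrite ?fctE /GRing.scale /= /GRing.scale /= -/r -/s -/c; field.
- apply: (split2 _ _ _ _ _ _ _ _
    (Z (v 0 1 * w 0 2 + v 0 2 * w 0 1) _ _ rVD)
    (cD (- (v 0 3 * w 0 3)) r) (is_derive_sincos _)).
    by apply/funext => q; rewrite !mxE /= ?fctE /GRing.scale /= /GRing.scale /=; ring.
  by rewrite ?fctE /GRing.scale /= /GRing.scale /= -/s -/c; field.
- apply: (split2 _ _ _ _ _ _ _ _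
    (Z (v 0 1 * w 0 3 + v 0 3 * w 0 1) _ _ rVD)
    (cD (v 0 2 * w 0 3 + v 0 3 * w 0 2) r) (is_derive_cot s0)).
    by apply/funext => q; rewrite !mxE /= ?fctE /GRing.scale /= /GRing.scale /=; ring.
  by rewrite ?fctE /GRing.scale /= /GRing.scale /= -/s -/c; field; rewrite ?r0 ?s0.
Qed.

(** The two mixed directions t and rho give the same value f'/(2 rho) because
    g_tt g_rr = -1; this is what leaves only three values. *)
Lemma riemann_op_static (p : 'rV[R]_4) (f2 : R) :
    let r := p 0 1 in
    f r != 0 -> r != 0 -> sin (p 0 2) != 0 ->
    (forall x : R, is_derive x 1 f (f1 x)) -> is_derive r 1 f1 f2 ->
  riemann_op static_metric p = diag_curv (static_coef p)
    (block_curv (f2 / 2) (f1 r / (2 * r)) ((f r - 1) / r ^+ 2)).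
Proof.
move=> r f0 r0 s0 fD f1D.
have near_chr := near_christoffel_form_static f0 r0 s0 fD.
apply/funext => u; apply/funext => v; apply/funext => w.
have dchr a b k : is_derive p a
    (fun q => christoffel_form static_metric q b w 0 k)
    (static_christoffel_deriv p f2 a b w 0 k).
  apply: (near_eq_is_derive (f := fun q => static_christoffel q b w 0 k)).
    by near=> q; rewrite (near near_chr q).
  exact: is_derive_static_christoffel.
rewrite (riemann_opE (dchr u v) (dchr v u)).
rewrite !christoffel_form_static //.
apply/rowP => k; rewrite !mxE sum_ord4 /block_curv /static_coef.
rewrite ?mxE /r; elim/ord4P: k => /=.
all: by field; rewrite ?f0 ?r0 ?s0.
Unshelve. all: by end_near. Qed.

End StaticSpherical.

(** * The Bardeen lapse function *)

Section BardeenCurvature.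
Set Implicit Arguments.
Unset Strict Implicit.
Variables (R : realType) (M e : R).
Hypothesis e_neq0 : e != 0.
Implicit Types (x : R).

Definition regular_radius x := Num.sqrt (e ^+ 2 + x ^+ 2).
Definition lapse x := 1 - 2 * M * x ^+ 2 / regular_radius x ^+ 3.
Definition lapse_d1 x := - (2 * M) *
  (2 * x / regular_radius x ^+ 3 - 3 * x ^+ 3 / regular_radius x ^+ 5).
Definition lapse_d2 x := - (2 * M) *
  (2 / regular_radius x ^+ 3 - 15 * x ^+ 2 / regular_radius x ^+ 5
   + 15 * x ^+ 4 / regular_radius x ^+ 7).

Lemma sum_sqr_gt0 x : 0 < e ^+ 2 + x ^+ 2.
Proof. by rewrite ltr_wpDr ?sqr_ge0 // exprn_even_gt0. Qed.

Lemma regular_radius_neq0 x : regular_radius x != 0.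
Proof. by rewrite gt_eqF // sqrtr_gt0 sum_sqr_gt0. Qed.

Lemma regular_radius_sqr x : regular_radius x ^+ 2 = e ^+ 2 + x ^+ 2.
Proof. by rewrite sqr_sqrtr // ltW // sum_sqr_gt0. Qed.

Lemma is_derive_regular_radius x : is_derive x 1 regular_radius (x / regular_radius x).
Proof.
have sq : is_derive x 1 (fun t => e ^+ 2 + t ^+ 2) (2 * x).
  have := is_deriveD (is_derive_cst (e ^+ 2) x 1) (is_derive_sqr x).
  by move/is_derive_eq; apply; rewrite add0r.
have := @is_derive1_comp _ Num.sqrt (fun t => e ^+ 2 + t ^+ 2) x _ _
  (is_derive1_sqrt (sum_sqr_gt0 x)) sq.
move/is_derive_eq; apply.
by have := regular_radius_neq0 x; rewrite /regular_radius => ?; field.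
Qed.

(** The lapse and its first derivative are linear combinations of such ratios. *)
Lemma is_derive_radius_ratio m n x :
  is_derive x 1 (fun t => t ^+ m.+1 / regular_radius t ^+ n.+1)
    (m.+1%:R * x ^+ m / regular_radius x ^+ n.+1
     - n.+1%:R * x ^+ m.+2 / regular_radius x ^+ n.+3).
Proof.
have VD := is_deriveV (regular_radius_neq0 x) (is_derive_regular_radius x).
have := is_deriveM (@is_deriveX _ _ id m.+1 x 1 1 (is_derive_id x 1))
                   (@is_deriveX _ _ _ n.+1 x 1 _ VD).
rewrite (_ : _ * _ = fun t => t ^+ m.+1 / regular_radius t ^+ n.+1); last first.
  by apply/funext => t; rewrite mulrfctE !exprfctE /= exprVn.
move/is_derive_eq; apply; rewrite !exprfctE /GRing.scale /= -!exprVn.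
by set w := (regular_radius x)^-1; rewrite !exprS; ring.
Qed.

Lemma is_derive_lapse x : is_derive x 1 lapse (lapse_d1 x).
Proof.
have := is_deriveB (is_derive_cst (1 : R) x 1)
  (is_deriveZ (2 * M) (is_derive_radius_ratio 1 2 x)).
rewrite (_ : _ - _ = lapse); last first.
  by apply/funext => t; rewrite /lapse -mulrA.
by move/is_derive_eq; apply; rewrite /lapse_d1 /GRing.scale /=; ring.
Qed.

Lemma is_derive_lapse_d1 x : is_derive x 1 lapse_d1 (lapse_d2 x).
Proof.
have := is_deriveZ (- (2 * M))
  (is_deriveB (is_deriveZ 2 (is_derive_radius_ratio 0 2 x))
              (is_deriveZ 3 (is_derive_radius_ratio 2 4 x))).
rewrite (_ : _ \*: _ = lapse_d1); last first.
  by apply/funext => t; rewrite /lapse_d1 -[2 * t / _]mulrA -[3 * _ / _]mulrA.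
by move/is_derive_eq; apply; rewrite /lapse_d2 /GRing.scale /=; ring.
Qed.

Lemma riemann_op_bardeen (p : 'rV[R]_4) : bardeen_spacetime M e p ->
  let r := bardeen_rho p in let r1 := bardeen_rho1 e p in
  riemann_op (bardeen_metric M e) p = diag_curv (static_coef lapse p)
    (block_curv
       (- (M * (2 / r1 ^+ 3 - 15 * r ^+ 2 / r1 ^+ 5 + 15 * r ^+ 4 / r1 ^+ 7)))
       (- (M * (2 * r1 ^+ 2 - 3 * r ^+ 2) / r1 ^+ 5))
       (- (2 * M / r1 ^+ 3)))
  /\ forall i, static_coef lapse p i != 0.
Proof.
case=> rho_gt0 theta_in rho1_neq r r1.
have r0 : r != 0 by rewrite gt_eqF.
have r10 : r1 != 0 by exact: regular_radius_neq0.
have s0 : sin (bardeen_theta p) != 0 by rewrite gt_eqF // sin_gt0_pi.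
have f0 : lapse r != 0.
  rewrite subr_eq0; apply: contraNneq rho1_neq => /esym h.
  have r13 : r1 ^+ 3 != 0 by rewrite expf_neq0.
  by apply/eqP; rewrite -[RHS](divfK r13) [X in X * _]h mul1r.
have radE : regular_radius r = r1 by [].
have -> : bardeen_metric M e = static_metric lapse by [].
rewrite (riemann_op_static f0 r0 s0 is_derive_lapse (is_derive_lapse_d1 r)).
rewrite -[p 0 1]/r; split; last by move=> i; exact: static_coef_neq0.
congr (diag_curv _ (block_curv _ _ _)).
- by rewrite /lapse_d2 radE; field.
- by rewrite /lapse_d1 radE; field; rewrite r10 r0.
- by rewrite /lapse radE; field; rewrite r10 r0.
Qed.

End BardeenCurvature.

(** * Pseudosymmetry of the Bardeen spacetime *)

Theorem corollary3p1 (R : realType) (M e : R) (M_neq0 : M != 0) (e_neq0 : e != 0)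
    (p : 'rV[R]_4) (p_in : bardeen_spacetime M e p) :
  let g := bardeen_metric M e in
  let rho := bardeen_rho p in
  let rho1 := bardeen_rho1 e p in
  let G := metric g p in
  let S := ricci g p in
  let kappa := scalar_curvature g p in
  let muR := riemann_op g p in
  let muC := weyl_op g p in
  let Rt := riemann g p in
  let Ct := weyl g p in
  let varrho1 := M * (18 * rho1 ^+ 2 - 25 * rho ^+ 2)
                 / (25 * rho ^+ 2 * rho1 ^+ 3) in
  let varrho2 := rho1 ^+ 2 * (6 * rho1 ^+ 2 - 5 * rho ^+ 2)
                 / (25 * e ^+ 2 * rho ^+ 2) in
  let varrho3 := (3 * rho1 ^+ 2 - 5 * rho ^+ 2) * rho1 ^+ 7
                 / (150 * M * e ^+ 4 * rho ^+ 2) in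
  let varrhoR := - (M * (2 * rho1 ^+ 2 - 3 * rho ^+ 2) / rho1 ^+ 5) in
  let varrhoC := - (M * rho ^+ 2 * (3 * rho1 ^+ 2 - 5 * rho ^+ 2)
                    / (2 * rho1 ^+ 7)) in
  let varrho := varrhoR + varrho2 / (2 * varrho3) in
  (* decomposition of R *)
  (forall z : 'I_4 -> 'rV[R]_4,
     Rt z = varrho1 * kulkarni_nomizu G G z + varrho2 * kulkarni_nomizu G S z
            + varrho3 * kulkarni_nomizu S S z) /\
  [/\ (* (i) *)
      (forall (z : 'I_4 -> 'rV[R]_4) (X Y : 'rV[R]_4),
         curv_dot muR Rt z X Y = varrhoR * tachibana G Rt z X Y) /\
      (varrho3 != 0 ->
         varrhoR = (2 * varrho3)^-1
                   * (2 * (varrho2 ^+ 2 - 4 * varrho3 * varrho1) - varrho2)),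
      (* (ii) *)
      (forall (z : 'I_4 -> 'rV[R]_4) (X Y : 'rV[R]_4),
         curv_dot muR Ct z X Y = varrhoR * tachibana G Ct z X Y),
      (* (iii) *)
      (forall (z : 'I_4 -> 'rV[R]_4) (X Y : 'rV[R]_4),
         curv_dot muC Rt z X Y = varrhoC * tachibana G Rt z X Y) /\
      (varrho3 != 0 ->
         varrhoC = varrhoR - (kappa / 3 + varrho2 / (2 * varrho3))
                   + (4 * varrho3)^-1),
      (* (iv) *)
      (forall (z : 'I_4 -> 'rV[R]_4) (X Y : 'rV[R]_4),
         curv_dot muC Ct z X Y = varrhoC * tachibana G Ct z X Y)
    & (* (v) *)
      3 * rho1 ^+ 2 != 5 * rho ^+ 2 ->
      (forall (z : 'I_4 -> 'rV[R]_4) (X Y : 'rV[R]_4),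
         curv_dot muR Rt z X Y =
         tachibana S Rt z X Y + varrho * tachibana G Ct z X Y) /\
      varrho = 2 * M * (6 * rho1 ^+ 2 - 7 * rho ^+ 2)
               / ((3 * rho1 ^+ 2 - 5 * rho ^+ 2) * rho1 ^+ 3)].
Proof.
move=> g rho rho1 G S kappa muR muC Rt Ct varrho1 varrho2 varrho3 varrhoR
  varrhoC varrho.
have r0 : rho != 0 by case: p_in => rho_gt0 _ _; rewrite gt_eqF.
have r10 : rho1 != 0 by exact: regular_radius_neq0.
have e2 : e ^+ 2 = rho1 ^+ 2 - rho ^+ 2.
  by rewrite /rho1 /rho regular_radius_sqr //; ring.
have e4 : e ^+ 4 = (rho1 ^+ 2 - rho ^+ 2) ^+ 2 by rewrite -e2 -exprM.
have D0 : rho1 ^+ 2 - rho ^+ 2 != 0 by rewrite -e2 expf_neq0.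
have gE : g p = diag_mx (\row_i static_coef (lapse M e) p i) by [].
have [] := riemann_op_bardeen e_neq0 p_in.
rewrite -/g -/muR -/rho -/rho1.
set a := - (M * (2 / _ - _ + _)); set b := - (M * _ / _); set d := - (2 * M / _).
move=> riemE c0.
(* Once e^2 is eliminated, rho1 and rho are independent and the identities
   are rational. *)
have roter : forall k i, k != i -> block_curv a b d k i = 2 * varrho1
    + varrho2 * (ricci_eigenvalue (block_curv a b d) k
                 + ricci_eigenvalue (block_curv a b d) i)
    + 2 * varrho3 * (ricci_eigenvalue (block_curv a b d) k
                     * ricci_eigenvalue (block_curv a b d) i).
  move=> k i _; apply: block_curv_roter.
  - rewrite /a /b /d /varrho1 /varrho2 /varrho3 e2 e4.
    by field; rewrite r10 r0 D0 M_neq0.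
  - rewrite /a /b /d /varrho1 /varrho2 /varrho3 e2 e4.
    by field; rewrite r10 r0 D0 M_neq0.
  - rewrite /a /b /d /varrho1 /varrho2 /varrho3 e2 e4.
    by field; rewrite r10 r0 D0 M_neq0.
have RtE : Rt = kn_poly varrho1 varrho2 varrho3 G S.
  by exact: (riemann_roter gE riemE roter).
have CtE := weyl_roter gE c0 riemE roter.
have kappaE : kappa = 2 * (a + 2 * b) + 2 * (d + 2 * b).
  rewrite /kappa (scalar_curvature_diag gE c0 riemE) sum_ord4.
  by rewrite !ricci_eigenvalue_block /=; ring.
have weylE := weyl_op_diag gE c0 riemE.
(* The mixed value of the diagonal coefficients of the Weyl operator. *)
have bC : b - (4%:R - 2)^-1 * ((a + 2 * b) + (d + 2 * b))
    + kappa / ((4%:R - 1) * (4%:R - 2)) = varrhoC.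
  by rewrite kappaE /a /b /d /varrhoC; field.
have dotR al be ga z X Y : curv_dot muR (kn_poly al be ga G S) z X Y =
    varrhoR * tachibana G (kn_poly al be ga G S) z X Y.
  apply: (curv_dot_roter gE riemE _ _ _ _ _ _ riemE); first exact: block_curv_sym.
  by move=> k i /block_curv_mixed ->.
have dotC al be ga z X Y : curv_dot muC (kn_poly al be ga G S) z X Y =
    varrhoC * tachibana G (kn_poly al be ga G S) z X Y.
  apply: (curv_dot_roter gE riemE _ _ _ _ _ _ weylE).
    by move=> k i; rewrite block_curv_sym [X in _ * X]addrC.
  move=> k i ki; rewrite (block_curv_mixed ki) -bC.
  move: ki; rewrite !ricci_eigenvalue_block.
  case: (k < 2)%N; case: (i < 2)%N; rewrite ?eqxx // => _.
  by rewrite [X in _ * X]addrC.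
(* The other factors of varrho3 never vanish. *)
have varrho3_neq0 : (varrho3 != 0) = (3 * rho1 ^+ 2 - 5 * rho ^+ 2 != 0).
  have unit_part : rho1 ^+ 7 / (150 * M * e ^+ 4 * rho ^+ 2) != 0.
    apply: mulf_neq0; first exact: expf_neq0.
    by rewrite invr_eq0 !mulf_neq0 ?expf_neq0 ?pnatr_eq0.
  by rewrite /varrho3 -mulrA mulf_eq0 (negPf unit_part) orbF.
split; first by move=> z; rewrite RtE.
split.
- split; first by move=> z X Y; rewrite RtE dotR.
  rewrite varrho3_neq0 => t0.
  rewrite /varrhoR /varrho1 /varrho2 /varrho3 e2 e4.
  by field; rewrite r10 t0 r0 D0 M_neq0.
- by move=> z X Y; rewrite /Ct CtE dotR.
- split; first by move=> z X Y; rewrite RtE dotC.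
  rewrite varrho3_neq0 => t0.
  rewrite kappaE /a /b /d /varrhoC /varrhoR /varrho2 /varrho3 e2 e4.
  by field; rewrite r10 t0 r0 D0 M_neq0.
- by move=> z X Y; rewrite /Ct CtE dotC.
- rewrite -subr_eq0 => t0; split; last first.
    rewrite /varrho /varrhoR /varrho2 /varrho3 e2 e4.
    by field; rewrite r10 t0 r0 D0 M_neq0.
  move=> z X Y; rewrite RtE dotR /Ct CtE.
  apply: (tachibana_roter_swap gE riemE).
    rewrite /varrho /varrhoR /varrho1 /varrho2 /varrho3 e2 e4.
    by field; rewrite r10 t0 r0 D0 M_neq0.
  have t3 : 2 * varrho3 != 0 by rewrite mulf_neq0 ?pnatr_eq0 ?varrho3_neq0.
  by rewrite [varrho * _]mulrDl (divfK t3) addrC addrK.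
Qed.
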